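(* Let $\Bbbk$ be an algebraically closed field of characteristic $0$. Let $A$ be a prime $\Bbbk$-algebra and let $G = \langle g \mid g^n\rangle$ be a finite cyclic group acting inner on $A$, so that there exists a unit $\eta \in A$ with $g^i\cdot a = \eta^i a \eta^{-i}$ for all $a\in A$ and all $i$. Suppose also that the skew group ring $T = A \,\#\, G$ is prime. Then $A$ is Azumaya if and only if $T$ is Azumaya, and in this case $A$ and $T$ have the same rank over their respective centres.
   Context: The skew group ring $A \,\#\, G$ is the free left $A$-module with basis $G$ and multiplication $(ag)(bh) = a\,(g\cdot b)\, gh$ for $a,b\in A$, $g,h\in G$. A ring $A$ with centre $Z$ is Azumaya (over its centre) if $A$ is a finitely generated projective $Z$-module and the map $A\otimes_Z A^{\mathrm{op}} \to \operatorname{End}_Z(A)$, $a\otimes b \mapsto (r\mapsto arb)$, is an isomorphism. If $A$ is prime Azumaya, then $\dim_{Z/\mathfrak{m}}(A/\mathfrak{m}A)$ is the same for all maximal ideals $\mathfrak{m}$ of $Z$; this value is the rank of $A$ over its centre. *)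

(* Defs.v *)
From HB Require Import structures.
From mathcomp Require Import all_boot all_order all_fingroup all_algebra.
From mathcomp Require Import generic_quotient boolp.

Set Implicit Arguments.
Unset Strict Implicit.
Unset Printing Implicit Defensive.

Import GRing.Theory.
Local Open Scope ring_scope.
Local Open Scope quotient_scope.

Section Prime.
Variable R : nzRingType.

Definition two_sided_ideal (I : R -> Prop) : Prop :=
  [/\ I 0,
      forall x y, I x -> I y -> I (x - y) &
      forall a x, I x -> I (a * x) /\ I (x * a)].

(* The hypothesis on I and J says that the product ideal I J vanishes: I J is
   additively generated by the products x * y.  That R is nonzero is part of
   nzRingType. *)
Definition prime_ring : Prop :=
  forall I J : R -> Prop, two_sided_ideal I -> two_sided_ideal J ->
    (forall x y, I x -> J y -> x * y = 0) ->
    (forall x, I x -> x = 0) \/ (forall y, J y -> y = 0).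

End Prime.

Section Centre.
Variable R : nzRingType.

Definition central : {pred R} := fun x => `[< forall y, x * y = y * x >].

Lemma centralP x : reflect (forall y, x * y = y * x) (x \in central).
Proof. exact: asboolP. Qed.

Lemma central_subring : subring_closed central.
Proof.
split=> [|x y /centralP cx /centralP cy|x y /centralP cx /centralP cy].
- by apply/centralP => y; rewrite mul1r mulr1.
- by apply/centralP => z; rewrite mulrBl mulrBr cx cy.
- by apply/centralP => z; rewrite -mulrA cy mulrA cx mulrA.
Qed.

HB.instance Definition _ :=
  GRing.isSubringClosed.Build R central central_subring.

Record centre := Centre { cval : R; cvalP : cval \in central }.

HB.instance Definition _ := [isSub for cval].
HB.instance Definition _ := [Choice of centre by <:].
HB.instance Definition _ := [SubChoice_isSubNzRing of centre by <:].

Lemma centre_mulC : @commutative centre centre *%R.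
Proof. by move=> x y; apply/val_inj/(centralP _ (cvalP x)). Qed.

HB.instance Definition _ := GRing.PzRing_hasCommutativeMul.Build centre centre_mulC.

Definition over_centre : Type := R.

HB.instance Definition _ := GRing.Zmodule.on over_centre.

Definition centre_scale (z : centre) (x : over_centre) : over_centre :=
  (cval z * x : R).

Fact centre_scaleA a b v :
  centre_scale a (centre_scale b v) = centre_scale (a * b) v.
Proof. exact: mulrA. Qed.
Fact centre_scale1 : left_id 1 centre_scale.
Proof. exact: mul1r. Qed.
Fact centre_scaleDr : right_distributive centre_scale +%R.
Proof. by move=> z x y; apply: mulrDr. Qed.
Fact centre_scaleDl v : {morph centre_scale^~ v : a b / a + b}.
Proof. by move=> a b; apply: mulrDl. Qed.

HB.instance Definition _ := GRing.Zmodule_isLmodule.Build centre over_centre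
  centre_scaleA centre_scale1 centre_scaleDr centre_scaleDl.

Lemma centre_scaleE (z : centre) (x : over_centre) :
  z *: x = (cval z * (x : R) : R).
Proof. by []. Qed.

End Centre.

Section Modules.
Variables (Z : nzRingType) (M : lmodType Z).

Definition finitely_generated : Prop :=
  exists (n : nat) (e : 'I_n -> M),
    forall x, exists c : 'I_n -> Z, x = \sum_i c i *: e i.

Definition projective : Prop :=
  forall (N P : lmodType Z) (f : {linear N -> P}) (h : {linear M -> P}),
    (forall p, exists x, f x = p) ->
    exists l : {linear M -> N}, forall x, f (l x) = h x.

Definition has_dimension (r : nat) : Prop :=
  exists e : 'I_r -> M,
    (forall x, exists c : 'I_r -> Z, x = \sum_i c i *: e i) /\
    (forall c : 'I_r -> Z, \sum_i c i *: e i = 0 -> forall i, c i = 0).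

End Modules.

Section TensorProduct.
Variables (Z : comNzRingType) (M N : lmodType Z).

Definition bilinear_map (P : lmodType Z) (b : M -> N -> P) : Prop :=
  [/\ forall z x x' y, b (z *: x + x') y = z *: b x y + b x' y &
      forall z x y y', b x (z *: y + y') = z *: b x y + b x y'].

Definition eval_sum (P : lmodType Z) (b : M -> N -> P) (s : seq (M * N)) : P :=
  \sum_(p <- s) b p.1 p.2.

(* A sequence s represents the formal sum of the x (x) y with (x, y) in s.  Two
   formal sums are equal in the tensor product when every bilinear map takes
   the same value on both; since the tensor product carries a universal
   bilinear map, this is the congruence generated by the usual relations. *)
Definition tensor_eq (s t : seq (M * N)) : bool :=
  `[< forall (P : lmodType Z) (b : M -> N -> P), bilinear_map b ->
        eval_sum b s = eval_sum b t >].

Lemma tensor_eqP s t :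
  reflect (forall (P : lmodType Z) (b : M -> N -> P), bilinear_map b ->
             eval_sum b s = eval_sum b t) (tensor_eq s t).
Proof. exact: asboolP. Qed.

Lemma tensor_eq_equiv : equiv_class_of tensor_eq.
Proof.
split=> [s|s t|t s u].
- exact/tensor_eqP.
- by apply/tensor_eqP/tensor_eqP => st P b bb; rewrite st.
- move=> /tensor_eqP st /tensor_eqP tu.
  by apply/tensor_eqP => P b bb; rewrite st ?tu.
Qed.

Canonical tensor_equiv := EquivRelPack tensor_eq_equiv.
Canonical tensor_encModRel := defaultEncModRel tensor_eq.

Definition tensor : Type := {eq_quot tensor_eq}.

HB.instance Definition _ : EqQuotient _ tensor_eq tensor := EqQuotient.on tensor.
HB.instance Definition _ := Choice.on tensor.

Definition tensor_lift (P : lmodType Z) (b : M -> N -> P) (t : tensor) : P :=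
  eval_sum b (repr t).

Lemma tensor_lift_pi (P : lmodType Z) (b : M -> N -> P) s :
  bilinear_map b -> tensor_lift b (\pi_tensor s) = eval_sum b s.
Proof.
move=> bb; apply: (tensor_eqP _ _ _) => //.
by have /eqP := reprK (\pi_tensor s); rewrite eqmodE.
Qed.

Lemma tensor_ext (t u : tensor) :
  (forall (P : lmodType Z) (b : M -> N -> P), bilinear_map b ->
     tensor_lift b t = tensor_lift b u) -> t = u.
Proof.
move=> tu; rewrite -[t]reprK -[u]reprK; apply/eqP; rewrite eqmodE.
exact/tensor_eqP.
Qed.

Definition tensor_zero : tensor := \pi_tensor [::].
Definition tensor_add (t u : tensor) : tensor := \pi_tensor (repr t ++ repr u).
Definition tensor_scale (z : Z) (t : tensor) : tensor :=
  \pi_tensor [seq (z *: p.1, p.2) | p <- repr t].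
Definition tensor_opp (t : tensor) : tensor := tensor_scale (-1) t.

Section Lift.
Variables (P : lmodType Z) (b : M -> N -> P).
Hypothesis bb : bilinear_map b.

Lemma tensor_lift0 : tensor_lift b tensor_zero = 0.
Proof. by rewrite tensor_lift_pi // /eval_sum big_nil. Qed.

Lemma tensor_liftD t u :
  tensor_lift b (tensor_add t u) = tensor_lift b t + tensor_lift b u.
Proof. by rewrite tensor_lift_pi // /eval_sum big_cat. Qed.

Lemma bilinear_mapZl z x y : b (z *: x) y = z *: b x y.
Proof.
case: bb => bl _; have b0 : b 0 y = 0.
  by have /(congr1 (+%R^~ (- b 0 y))) := bl 1 0 0 y; rewrite !scale1r addr0 addrK subrr.
by have := bl z x 0 y; rewrite addr0 b0 addr0.
Qed.

Lemma tensor_liftZ z t : tensor_lift b (tensor_scale z t) = z *: tensor_lift b t.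
Proof.
rewrite tensor_lift_pi // /tensor_lift /eval_sum big_map scaler_sumr.
by apply: eq_bigr => p _; apply: bilinear_mapZl.
Qed.

End Lift.

Fact tensor_addA : associative tensor_add.
Proof. by move=> t u v; apply: tensor_ext => P b bb; rewrite !tensor_liftD // addrA. Qed.
Fact tensor_addC : commutative tensor_add.
Proof. by move=> t u; apply: tensor_ext => P b bb; rewrite !tensor_liftD // addrC. Qed.
Fact tensor_add0 : left_id tensor_zero tensor_add.
Proof.
by move=> t; apply: tensor_ext => P b bb; rewrite tensor_liftD // tensor_lift0 // add0r.
Qed.
Fact tensor_addN : left_inverse tensor_zero tensor_opp tensor_add.
Proof.
move=> t; apply: tensor_ext => P b bb.
by rewrite tensor_liftD // tensor_liftZ // tensor_lift0 // scaleN1r addNr.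
Qed.

HB.instance Definition _ :=
  GRing.isZmodule.Build tensor tensor_addA tensor_addC tensor_add0 tensor_addN.

Fact tensor_scaleA a b v : tensor_scale a (tensor_scale b v) = tensor_scale (a * b) v.
Proof. by apply: tensor_ext => P f bf; rewrite !tensor_liftZ // scalerA. Qed.
Fact tensor_scale1 : left_id 1 tensor_scale.
Proof. by move=> v; apply: tensor_ext => P f bf; rewrite !tensor_liftZ // scale1r. Qed.
Fact tensor_scaleDr : right_distributive tensor_scale +%R.
Proof.
move=> a u v; apply: tensor_ext => P f bf.
by rewrite tensor_liftZ // !tensor_liftD // !tensor_liftZ // scalerDr.
Qed.
Fact tensor_scaleDl v : {morph tensor_scale^~ v : a b / a + b}.
Proof.
move=> a b; apply: tensor_ext => P f bf.
by rewrite tensor_liftD // !tensor_liftZ // scalerDl.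
Qed.

HB.instance Definition _ := GRing.Zmodule_isLmodule.Build Z tensor
  tensor_scaleA tensor_scale1 tensor_scaleDr tensor_scaleDl.

Definition pure_tensor (x : M) (y : N) : tensor := \pi_tensor [:: (x, y)].

Lemma tensor_lift_pure (P : lmodType Z) (b : M -> N -> P) x y :
  bilinear_map b -> tensor_lift b (pure_tensor x y) = b x y.
Proof. by move=> bb; rewrite tensor_lift_pi // /eval_sum big_seq1. Qed.

Lemma pure_tensor_bilinear : bilinear_map pure_tensor.
Proof.
split=> z x y w; apply: tensor_ext => P b bb;
  rewrite tensor_liftD // tensor_liftZ // !tensor_lift_pure //.
- by case: bb => ->.
- by case: bb => _ ->.
Qed.

Lemma tensor_lift_linear (P : lmodType Z) (b : M -> N -> P) :
  bilinear_map b -> linear (tensor_lift b).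
Proof. by move=> bb z t u; rewrite tensor_liftD // tensor_liftZ. Qed.

Lemma tensor_lift_unique (P : lmodType Z) (f : {linear tensor -> P}) :
  f =1 tensor_lift (fun x y => f (pure_tensor x y)).
Proof.
move=> t; rewrite /tensor_lift /eval_sum -linear_sum; congr (f _).
rewrite -[LHS]reprK; elim: (repr t) => [|[x y] s IHs].
  by rewrite big_nil.
rewrite big_cons -{}IHs; apply: tensor_ext => P' b bb.
rewrite tensor_liftD // tensor_lift_pure // !tensor_lift_pi //.
by rewrite /eval_sum big_cons.
Qed.

End TensorProduct.

Section Azumaya.
Variable R : nzRingType.
Local Notation Z := (centre R).
Local Notation M := (over_centre R).

Definition sandwich (r a b : M) : M := (a * r * b : R).

Lemma sandwich_bilinear (r : M) : bilinear_map (sandwich r).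
Proof.
have l (z x x' y r' : R) : (z * x + x') * r' * y = z * (x * r' * y) + x' * r' * y.
  by rewrite !mulrDl !mulrA.
have c (z x y y' r' : R) : z * x = x * z -> z * r' = r' * z ->
    x * r' * (z * y + y') = z * (x * r' * y) + x * r' * y'.
  by move=> zx zr; rewrite mulrDr !mulrA zx -(mulrA x) -zr mulrA.
split=> z x y w; first exact: l.
by apply: c; apply/(centralP _ (cvalP z)).
Qed.

(* The action on r of the image of t; R^op has the same underlying Z-module
   as R, because Z acts centrally. *)
Definition azumaya_fun (t : tensor M M) (r : M) : M := tensor_lift (sandwich r) t.

Lemma azumaya_fun_linear t : linear (azumaya_fun t).
Proof.
have l (z x y a b : R) : z * a = a * z ->
    a * (z * x + y) * b = z * (a * x * b) + a * y * b.
  by move=> za; rewrite mulrDr mulrDl !mulrA za.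
move=> z x y; rewrite /azumaya_fun /tensor_lift /eval_sum scaler_sumr -big_split /=.
by apply: eq_bigr => p _; apply: l; apply/(centralP _ (cvalP z)).
Qed.

HB.instance Definition _ t :=
  GRing.isLinear.Build Z M M *:%R (azumaya_fun t) (azumaya_fun_linear t).

Definition azumaya_map (t : tensor M M) : {linear M -> M} := azumaya_fun t.

Lemma azumaya_map_pure (a b r : M) :
  azumaya_map (pure_tensor a b) r = (a * r * b : R).
Proof. exact/tensor_lift_pure/sandwich_bilinear. Qed.

Definition azumaya : Prop :=
  [/\ finitely_generated M, projective M & bijective azumaya_map].

End Azumaya.

Section Reduction.
Variables (Z : comNzRingType) (m : idealr Z) (M : lmodType Z).

(* The submodule m M of finite sums of products z *: x with z in m. *)
Definition ideal_mul : {pred M} := fun x =>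
  `[< exists s : seq (Z * M),
        all (fun p => p.1 \in m) s /\ x = \sum_(p <- s) p.1 *: p.2 >].

Lemma ideal_mulP x : reflect (exists s : seq (Z * M),
    all (fun p => p.1 \in m) s /\ x = \sum_(p <- s) p.1 *: p.2)
  (x \in ideal_mul).
Proof. exact: asboolP. Qed.

Lemma ideal_mul_submod : submod_closed ideal_mul.
Proof.
split=> [|a x y /ideal_mulP[s [ms ->]] /ideal_mulP[t [mt ->]]].
  by apply/ideal_mulP; exists [::]; rewrite big_nil.
apply/ideal_mulP; exists ([seq (a * p.1, p.2) | p <- s] ++ t); split.
  rewrite all_cat mt andbT all_map; apply: sub_all ms => p /=.
  exact: idealMr.
rewrite big_cat big_map scaler_sumr; congr (_ + _).
by apply: eq_bigr => p _; rewrite scalerA.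
Qed.

HB.instance Definition _ :=
  GRing.isSubmodClosed.Build Z M ideal_mul ideal_mul_submod.

Lemma ideal_mulZ z x : z \in m -> z *: x \in ideal_mul.
Proof.
move=> mz; apply/ideal_mulP; exists [:: (z, x)].
by rewrite big_seq1 /= mz.
Qed.

(* M / m M, as a module over Z / m. *)
Definition reduction : Type := Quotient.quot ideal_mul.

HB.instance Definition _ := GRing.Zmodule.on reduction.

Definition reduction_scale (z : {ideal_quot m}) (x : reduction) : reduction :=
  \pi_reduction (repr z *: repr x).

Lemma reduction_scale_pi (z : Z) (x : M) :
  reduction_scale (\pi_{ideal_quot m} z) (\pi_reduction x)
    = \pi_reduction (z *: x).
Proof.
apply/eqP; rewrite -Quotient.idealrBE.
set z' := repr _; set x' := repr _.
have mz : z' - z \in m by rewrite Quotient.idealrBE reprK.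
have mx : x' - x \in ideal_mul by rewrite Quotient.idealrBE reprK.
have -> : z' *: x' - z *: x = (z' - z) *: x' + z *: (x' - x).
  by rewrite scalerBl scalerBr addrA subrK.
by apply: rpredD; [apply: ideal_mulZ | apply: rpredZ].
Qed.

Fact reduction_scaleA a b v :
  reduction_scale a (reduction_scale b v) = reduction_scale (a * b) v.
Proof.
elim/quotW: a => a; elim/quotW: b => b; elim/quotW: v => v.
rewrite (reduction_scale_pi b v) reduction_scale_pi scalerA.
by rewrite -reduction_scale_pi rmorphM.
Qed.
Fact reduction_scale1 : left_id 1 reduction_scale.
Proof.
elim/quotW=> v; rewrite -[1](rmorph1 \pi_{ideal_quot m}).
by rewrite reduction_scale_pi scale1r.
Qed.
Fact reduction_scaleDr : right_distributive reduction_scale +%R.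
Proof.
elim/quotW=> a; elim/quotW=> u; elim/quotW=> v; rewrite -raddfD.
by rewrite !reduction_scale_pi scalerDr raddfD.
Qed.
Fact reduction_scaleDl v : {morph reduction_scale^~ v : a b / a + b}.
Proof.
elim/quotW=> a; elim/quotW=> b; elim/quotW: v => v; rewrite -raddfD.
by rewrite !reduction_scale_pi scalerDl raddfD.
Qed.

HB.instance Definition _ := GRing.Zmodule_isLmodule.Build {ideal_quot m} reduction
  reduction_scaleA reduction_scale1 reduction_scaleDr reduction_scaleDl.

End Reduction.

(* An idealr is proper, so the ideals compared with m are the proper ones. *)
Definition maximal_ideal (Z : comNzRingType) (m : idealr Z) : Prop :=
  forall J : idealr Z, {subset m <= J} -> {subset J <= m}.

Definition has_rank (R : nzRingType) (r : nat) : Prop :=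
  forall m : idealr (centre R), maximal_ideal m ->
    has_dimension (reduction m (over_centre R)) r.

Record group_action (gT : finGroupType) (k : nzRingType) (A : algType k) :=
  GroupAction {
    act_fun :> gT -> {lrmorphism A -> A};
    act_fun1 : act_fun 1%g =1 id;
    act_funM : forall g h, act_fun (g * h)%g =1 act_fun g \o act_fun h
  }.

(* The function f stands for the sum over g of f g times the basis element g.
   The multiplication, given below, depends on the action. *)
Definition skew_group_ring (gT : finGroupType) (k : nzRingType) (A : algType k)
  (act : group_action gT A) : Type := {ffun gT -> A}.

Section SkewGroupRing.
Variables (gT : finGroupType) (k : nzRingType) (A : algType k).
Variable act : group_action gT A.
Local Notation T := (skew_group_ring act).

HB.instance Definition _ := GRing.Zmodule.on T.

Definition skew_monomial (a : A) (g : gT) : T :=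
  [ffun x => if x == g then a else 0].

Definition skew_one : T := skew_monomial 1 1%g.

(* The coefficient of x in the product: the pairs (g, h) with g h = x. *)
Definition skew_mul (f f' : T) : T :=
  [ffun x => \sum_(g : gT) f g * act g (f' (g^-1 * x)%g)].

Fact skew_mulA : associative skew_mul.
Proof.
move=> f1 f2 f3; apply/ffunP => x; rewrite !ffunE.
under eq_bigr => g _ do rewrite ffunE raddf_sum mulr_sumr.
under [RHS]eq_bigr => g _ do rewrite ffunE mulr_suml.
rewrite [RHS]exchange_big /=; apply: eq_bigr => g _.
rewrite [RHS](reindex_inj (mulgI g)) /=; apply: eq_bigr => h _.
by rewrite rmorphM /= mulKg invMg mulgA act_funM mulrA /= -!mulgA.
Qed.
Fact skew_mul1 : left_id skew_one skew_mul.
Proof.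
move=> f; apply/ffunP => x; rewrite ffunE (bigD1 1%g) //= big1 => [|g ng1].
  by rewrite ffunE eqxx mul1r act_fun1 invg1 mul1g addr0.
by rewrite ffunE (negPf ng1) mul0r.
Qed.
Fact skew_mulr1 : right_id skew_one skew_mul.
Proof.
move=> f; apply/ffunP => x; rewrite ffunE (bigD1 x) //= big1 => [|g ngx].
  by rewrite ffunE mulVg eqxx rmorph1 mulr1 addr0.
by rewrite ffunE -eq_mulVg1 (negPf ngx) raddf0 mulr0.
Qed.
Fact skew_mulDl : left_distributive skew_mul +%R.
Proof.
move=> f1 f2 f3; apply/ffunP => x; rewrite !ffunE -big_split /=.
by apply: eq_bigr => g _; rewrite ffunE mulrDl.
Qed.
Fact skew_mulDr : right_distributive skew_mul +%R.
Proof.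
move=> f1 f2 f3; apply/ffunP => x; rewrite !ffunE -big_split /=.
by apply: eq_bigr => g _; rewrite ffunE raddfD mulrDr.
Qed.
Fact skew_one_neq0 : skew_one != 0.
Proof.
by apply/eqP => /ffunP/(_ 1%g); rewrite !ffunE eqxx; apply/eqP/oner_neq0.
Qed.

HB.instance Definition _ := GRing.Zmodule_isNzRing.Build T
  skew_mulA skew_mul1 skew_mulr1 skew_mulDl skew_mulDr skew_one_neq0.

Lemma skew_monomialM (a b : A) (g h : gT) :
  skew_monomial a g * skew_monomial b h = skew_monomial (a * act g b) (g * h)%g.
Proof.
apply/ffunP => x; rewrite !ffunE (bigD1 g) //= big1 => [|y nyg].
  rewrite !ffunE eqxx addr0 -(inj_eq (mulgI g)) mulKVg.
  by case: eqP => // _; rewrite raddf0 mulr0.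
by rewrite ffunE (negPf nyg) mul0r.
Qed.

Lemma skew_decomposition (f : T) : f = \sum_g skew_monomial (f g) g.
Proof.
apply/ffunP => x; rewrite sum_ffunE (bigD1 x) //= big1 => [|g ngx].
  by rewrite ffunE eqxx addr0.
by rewrite ffunE eq_sym (negPf ngx).
Qed.

End SkewGroupRing.

(* Main.v *)
Require Import Defs.
From HB Require Import structures.
From mathcomp Require Import all_boot all_order all_fingroup all_algebra.
From mathcomp Require Import generic_quotient boolp.

Set Implicit Arguments.
Unset Strict Implicit.
Unset Printing Implicit Defensive.

Import GRing.Theory.
Local Open Scope ring_scope.
Local Open Scope quotient_scope.

(** Write Z(R) for the centre of R.  The action is undone by a change of basis:
    u = eta^-1 g is central in T, so T is free over A on the central elements
    u^i, in other words T = A (x)_Z(A) S for a free commutative Z(A)-algebra S.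
    The Azumaya property goes up and down along such an extension, and the rank
    is unchanged.  All of this is done with elements, by means of a criterion
    that avoids tensor products.

    A ring R is Azumaya if and only if it has elements e_i and finite families of
    pairs (a_ij, b_ij) such that the operators f_i(x) = sum_j a_ij x b_ij take
    central values and x = sum_i f_i(x) e_i for all x
    ([azumaya_system_exists], [azumaya_of_system]).  One direction takes a dual
    basis (e_i, f_i) of R over Z(R), seeing f_i as an endomorphism of R, hence as
    the image of a tensor.  In the other direction, R is finitely generated
    projective because (e_i, f_i) is a dual basis, and the bijectivity of
    R (x) R^op -> End(R) is a computation with this dual basis.

    Such a system of A is still one of T, because its operators act on the
    coefficients of the u^i separately ([azumaya_system_ascent]).  Conversely,
    for a system of T the coefficients of f_i(x), with x in A, are again
    operators x |-> sum a x b with a and b in A, and they have central values;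
    reading off one coefficient of x = sum_i f_i(x) e_i gives a system of A
    ([azumaya_system_descent]).

    The rank is read off the element sum_i f_i(e_i), which is the trace of the
    idempotent matrix (f_j(e_i)) over Z(R).  When R is prime Z(R) is a domain,
    and over its field of fractions the trace of an idempotent matrix is its
    rank, so that sum_i f_i(e_i) is a natural number r ([prime_system_trace]).
    Modulo a maximal ideal m of Z(R) the same trace is the dimension of R / m R;
    as k has characteristic 0, natural numbers are distinct in Z(R) / m, so this
    dimension is r ([rank_of_system_trace]).  The system of T coming from A has
    the same trace r, whence the equality of ranks. *)

(** * Dual bases of modules *)

Definition linear_of (Z : nzRingType) (M N : lmodType Z) (f : M -> N)
    (lin_f : linear f) : {linear M -> N} :=
  HB.pack_for {linear M -> N} f (GRing.isLinear.Build Z M N *:%R f lin_f).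

Lemma linear_eq (Z : nzRingType) (M N : lmodType Z) (f g : {linear M -> N}) :
  f =1 g -> f = g.
Proof.
case: f g => [f cf] [g cg] /= fg; have {}fg: f = g by apply/funext.
subst g; congr GRing.Linear.Pack; case: cf cg => [[a] [b]] [[a'] [b']].
by rewrite (Prop_irrelevance a a') (Prop_irrelevance b b').
Qed.

Section LinearCombinations.
Variables (Z : comNzRingType) (M : lmodType Z).

Definition dual_basis (I : finType) (e : I -> M) (f : I -> M -> Z) : Prop :=
  (forall i, scalar (f i)) /\ forall x, x = \sum_i f i x *: e i.

Definition lincomb n (e : 'I_n -> M) (c : 'rV[Z]_n) : M := \sum_i c 0 i *: e i.

Fact lincomb_linear n (e : 'I_n -> M) : linear (lincomb e).
Proof.
move=> a c d; rewrite /lincomb scaler_sumr -big_split; apply: eq_bigr => i _.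
by rewrite !mxE scalerDl scalerA.
Qed.

HB.instance Definition _ n (e : 'I_n -> M) :=
  GRing.isLinear.Build Z 'rV[Z]_n M *:%R (lincomb e) (lincomb_linear e).

Lemma scalar_sum (f : M -> Z) (J : Type) (r : seq J) (c : J -> Z) (x : J -> M) :
  scalar f -> f (\sum_(j <- r) c j *: x j) = \sum_(j <- r) c j * f (x j).
Proof.
move=> lf; elim: r => [|j r IHr]; last by rewrite !big_cons lf IHr.
by have := lf (-1) 0 0; rewrite !big_nil scaler0 addr0 mulN1r addNr.
Qed.

(** The identity of M lifts through the map from the free module onto M given by
    the generators; the components of the lift are the coordinates. *)
Lemma fg_projective_dual_basis :
  finitely_generated M -> projective M ->
  exists n (e : 'I_n -> M) (f : 'I_n -> M -> Z), dual_basis e f.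
Proof.
case=> n [e gen_e] projM.
case: (projM 'rV[Z]_n M (lincomb e) idfun) => [x|l lK].
  case: (gen_e x) => c ->; exists (\row_i c i).
  by apply: eq_bigr => i _; rewrite mxE.
exists n, e, (fun i x => l x 0 i); split=> [i a x y|x]; last by rewrite -{1}[x]lK.
by rewrite linearP !mxE.
Qed.

Lemma dual_basis_fg (I : finType) (e : I -> M) (f : I -> M -> Z) :
  dual_basis e f -> finitely_generated M.
Proof.
case=> _ ef; exists #|I|, (e \o enum_val) => x; exists (f^~ x \o enum_val).
by rewrite {1}[x]ef big_enum_val.
Qed.

Lemma dual_basis_projective (I : finType) (e : I -> M) (f : I -> M -> Z) :
  dual_basis e f -> projective M.
Proof.
case=> lf ef N P p h surj.
have /choice[y yE] i : exists y, p y = h (e i) by exact: surj.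
pose l x := \sum_i f i x *: y i.
have l_lin : linear l.
  move=> a u v; rewrite /l scaler_sumr -big_split; apply: eq_bigr => i _.
  by rewrite lf scalerDl scalerA.
exists (linear_of l_lin) => x.
rewrite /= linear_sum {2}[x]ef linear_sum.
by apply: eq_bigr => i _; rewrite !linearZ yE.
Qed.

End LinearCombinations.

(** * Azumaya systems *)

Lemma tensor_lift_sum (Z : comNzRingType) (M N P : lmodType Z) (b : M -> N -> P)
    (J : Type) (r : seq J) (t : J -> tensor M N) :
  bilinear_map b ->
  tensor_lift b (\sum_(j <- r) t j) = \sum_(j <- r) tensor_lift b (t j).
Proof.
move=> bb; elim: r => [|j r IHr]; first by rewrite !big_nil tensor_lift0.
by rewrite !big_cons tensor_liftD // IHr.
Qed.

Section System.
Variable R : nzRingType.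
Local Notation Z := (centre R).
Local Notation M := (over_centre R).

Definition mult_op (s : seq (R * R)) (x : R) : R := \sum_(p <- s) p.1 * x * p.2.

Lemma mult_op_central s (z x : R) :
  z \in @central R -> mult_op s (z * x) = z * mult_op s x.
Proof.
move/centralP=> cz; rewrite /mult_op mulr_sumr; apply: eq_bigr => p _.
by rewrite !mulrA cz.
Qed.

Lemma mult_opD s (x y : R) : mult_op s (x + y) = mult_op s x + mult_op s y.
Proof.
by rewrite /mult_op -big_split; apply: eq_bigr => p _; rewrite mulrDr mulrDl.
Qed.

Lemma mult_op_sum s (J : Type) (r : seq J) (x : J -> R) :
  mult_op s (\sum_(j <- r) x j) = \sum_(j <- r) mult_op s (x j).
Proof.
rewrite /mult_op exchange_big; apply: eq_bigr => p _.
by rewrite mulr_sumr mulr_suml.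
Qed.

(** A dual basis of R over its centre whose coordinate functions are given by
    multiplications on both sides. *)
Definition azumaya_system (I : finType) (e : I -> R)
    (s : I -> seq (R * R)) : Prop :=
  (forall i x, mult_op (s i) x \in @central R) /\
  forall x, x = \sum_i mult_op (s i) x * e i.

(** A coordinate function of a dual basis has values in the centre, so it is also
    an endomorphism of R, and its preimage under the isomorphism from the tensor
    product provides the pairs. *)
Lemma azumaya_system_exists :
  azumaya R -> exists n (e : 'I_n -> R) s, azumaya_system e s.
Proof.
case=> fgM projM [inv _ invK].
have [n [e [f [lf ef]]]] := fg_projective_dual_basis fgM projM.
pose phi i (x : M) : M := (cval (f i x) : R).
have phi_lin i : linear (phi i) by move=> a x y; rewrite /phi lf.
pose Phi i := linear_of (phi_lin i).
have sE i (x : M) : mult_op (repr (inv (Phi i))) x = cval (f i x).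
  by have /(congr1 (fun u : {linear M -> M} => u x)) := invK (Phi i).
exists n, e, (fun i => repr (inv (Phi i))); split=> [i x|x].
  by rewrite sE cvalP.
by rewrite {1}[x]ef; apply: eq_bigr => i _; rewrite sE.
Qed.

Section FromSystem.
Variables (I : finType) (e : I -> R) (s : I -> seq (R * R)).
Hypothesis es : azumaya_system e s.

Definition coordinate (i : I) (x : M) : Z := Centre (es.1 i x).

Lemma system_dual_basis : dual_basis (e : I -> M) coordinate.
Proof.
split=> [i a x y|x]; last exact: es.2.
by apply: val_inj; rewrite /= mult_opD mult_op_central ?cvalP.
Qed.

(** If phi is x |-> sum_q c_q x d_q, then f_i(d_q) is central, and
      sum_q c_q (x) d_q = sum_(q, i) c_q f_i(d_q) (x) e_i
                        = sum_(i, p) phi(p.1) p.2 (x) e_i,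
    with p running over the pairs of f_i.  The last expression makes sense for
    every endomorphism phi. *)
Definition system_inv (phi : {linear M -> M}) : tensor M M :=
  \sum_i \sum_(p <- s i) @pure_tensor Z M M (phi p.1 * p.2 : R) (e i : M).

Lemma azumaya_mapK : cancel (@azumaya_map R) system_inv.
Proof.
move=> t; apply: tensor_ext => P b bb.
have bl y : linear (b^~ y) by move=> z x x'; case: bb => ->.
have br x : linear (b x) by move=> z y y'; case: bb => _ ->.
rewrite tensor_lift_sum //.
under eq_bigr => i _.
  rewrite tensor_lift_sum //.
  under eq_bigr => p _ do rewrite tensor_lift_pure //.
  over.
rewrite /tensor_lift /eval_sum.
have expand q : b q.1 q.2 =
    \sum_i \sum_(p <- s i) b (q.1 * p.1 * q.2 * p.2 : R) (e i).
  rewrite {1}[q.2](system_dual_basis.2) [LHS](linear_sum (linear_of (br q.1))).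
  apply: eq_bigr => i _; rewrite [LHS](linearZ_LR (linear_of (br q.1))) /=.
  rewrite -[LHS](linearZ_LR (linear_of (bl (e i)))).
  rewrite -[RHS](linear_sum (linear_of (bl (e i)))) /=.
  congr (b _ _); rewrite centre_scaleE /=.
  rewrite (centralP _ (es.1 i q.2)) /mult_op mulr_sumr.
  by apply: eq_bigr => p _; rewrite !mulrA.
under [RHS]eq_bigr => q _ do rewrite expand.
rewrite [RHS]exchange_big; apply: eq_bigr => i _.
rewrite [RHS]exchange_big; apply: eq_bigr => p _.
rewrite -[RHS](linear_sum (linear_of (bl (e i)))) /=; congr (b _ _).
by rewrite /azumaya_fun /tensor_lift /eval_sum /sandwich mulr_suml.
Qed.

(** The coordinates of x are central, so phi(x) = sum_i f_i(x) phi(e_i), and this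
    is a sum of products a x b. *)
Lemma azumaya_map_surj (phi : {linear M -> M}) : exists t, azumaya_map t = phi.
Proof.
exists (\sum_i \sum_(p <- s i) @pure_tensor Z M M (p.1 : M) (p.2 * phi (e i) : R)).
apply: linear_eq => x; rewrite /= /azumaya_fun.
have bb := sandwich_bilinear x.
rewrite tensor_lift_sum // [in RHS](system_dual_basis.2 x) linear_sum.
apply: eq_bigr => i _; rewrite tensor_lift_sum // linearZ.
rewrite [RHS]centre_scaleE /= /mult_op mulr_suml; apply: eq_bigr => p _.
by rewrite tensor_lift_pure // /sandwich !mulrA.
Qed.

Lemma azumaya_of_system : azumaya R.
Proof.
split.
- exact: dual_basis_fg system_dual_basis.
- exact: dual_basis_projective system_dual_basis.
exists system_inv; first exact: azumaya_mapK.
by move=> phi; have [t <-] := azumaya_map_surj phi; rewrite azumaya_mapK.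
Qed.

End FromSystem.
End System.

(** * Extensions with a central basis *)

Section CentralBasis.
Variables (A T : nzRingType) (iota : {rmorphism A -> T}).
Variables (I : finType) (w : I -> T) (co : I -> T -> A).

(** Freeness over A is expressed by an explicit coefficient function co, since the
    descent of Azumaya systems is written with the coefficients. *)
Definition central_basis : Prop :=
  [/\ forall i, w i \in @central T,
      forall t, t = \sum_i iota (co i t) * w i &
      forall (c : I -> A) i, co i (\sum_j iota (c j) * w j) = c i].

Hypothesis cb : central_basis.

Let w_comm i t : w i * t = t * w i.
Proof. by case: cb => /(_ i)/centralP wi _ _; apply: wi. Qed.

Let expand t : t = \sum_i iota (co i t) * w i.
Proof. by case: cb. Qed.

Let coK c i : co i (\sum_j iota (c j) * w j) = c i.
Proof. by case: cb. Qed.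

Lemma coordZl i a t : co i (iota a * t) = a * co i t.
Proof.
rewrite {1}[t]expand mulr_sumr -[RHS](coK (fun j => a * co j t)); congr (co i _).
by apply: eq_bigr => j _; rewrite rmorphM mulrA.
Qed.

Lemma coordZr i a t : co i (t * iota a) = co i t * a.
Proof.
rewrite {1}[t]expand mulr_suml -[RHS](coK (fun j => co j t * a)); congr (co i _).
by apply: eq_bigr => j _; rewrite rmorphM -mulrA w_comm mulrA.
Qed.

Lemma coord_sum i (J : Type) (r : seq J) (t : J -> T) :
  co i (\sum_(j <- r) t j) = \sum_(j <- r) co i (t j).
Proof.
rewrite -[RHS](coK (fun l => \sum_(j <- r) co l (t j))); congr (co i _).
under [RHS]eq_bigr => l _ do rewrite rmorph_sum mulr_suml.
by rewrite exchange_big; apply: eq_bigr => j _; apply: expand.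
Qed.

Lemma coord_central i t : t \in @central T -> co i t \in @central A.
Proof. by move/centralP=> ct; apply/centralP => a; rewrite -coordZr -coordZl ct. Qed.

Lemma image_central z : z \in @central A -> iota z \in @central T.
Proof.
move/centralP=> cz; apply/centralP => t.
rewrite [t]expand mulr_sumr mulr_suml; apply: eq_bigr => i _.
by rewrite -(mulrA _ (w i)) w_comm !mulrA -!rmorphM cz.
Qed.

Definition image_pairs (s : seq (A * A)) : seq (T * T) :=
  [seq (iota p.1, iota p.2) | p <- s].

Lemma mult_op_image s x : mult_op (image_pairs s) (iota x) = iota (mult_op s x).
Proof.
rewrite /mult_op big_map rmorph_sum; apply: eq_bigr => p _.
by rewrite !rmorphM.
Qed.

Lemma mult_op_image_coord s t :
  mult_op (image_pairs s) t = \sum_i iota (mult_op s (co i t)) * w i.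
Proof.
rewrite {1}[t]expand mult_op_sum; apply: eq_bigr => i _.
by rewrite -w_comm mult_op_central ?mult_op_image ?w_comm //; case: cb.
Qed.

(** By [mult_op_image_coord] the operators of A act on T coefficientwise. *)
Lemma azumaya_system_ascent (J : finType) (e : J -> A) s :
  azumaya_system e s ->
  azumaya_system (fun j => iota (e j)) (fun j => image_pairs (s j)).
Proof.
case=> cs es; split=> [j t|t].
  rewrite mult_op_image_coord rpred_sum // => i _; apply: rpredM.
    exact/image_central/cs.
  by case: cb.
under eq_bigr => j _ do rewrite mult_op_image_coord mulr_suml.
rewrite exchange_big {1}[t]expand; apply: eq_bigr => i _.
rewrite {1}[co i t]es rmorph_sum mulr_suml; apply: eq_bigr => j _.
by rewrite rmorphM -!mulrA w_comm.
Qed.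

(** Expanding both factors of a * iota x * b in the basis w leaves products of x
    with elements of A, multiplied by w_i w_j; the coefficient of w_l in w_i w_j
    goes into the right factor. *)
Definition coord_pairs (l : I) (s : seq (T * T)) : seq (A * A) :=
  [seq (co u.1 p.1, co u.2 p.2 * co l (w u.1 * w u.2))
     | p <- s, u <- index_enum (I * I)%type].

Lemma coord_mult_op l s x : co l (mult_op s (iota x)) = mult_op (coord_pairs l s) x.
Proof.
rewrite /mult_op /coord_pairs big_allpairs_dep coord_sum; apply: eq_bigr => p _.
rewrite {1}[p.1]expand {1}[p.2]expand mulr_suml big_distrlr.
rewrite pair_big coord_sum; apply: eq_bigr => u _ /=.
by rewrite -!mulrA (w_comm u.1) -!mulrA !coordZl -(w_comm u.1).
Qed.

(** The system of A is indexed by the pairs (j, i): the coordinate is the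
    coefficient of w_i in f_j(iota x).  The identity x = sum_j f_j(x) e_j of T is
    applied to iota x * w_k0 and read at the coefficient of w_k0, for an arbitrary
    index k0; this works whether or not 1 belongs to the basis. *)
Lemma azumaya_system_descent (k0 : I) (J : finType) (e : J -> T) s :
  azumaya_system e s ->
  azumaya_system (fun u : J * I => co k0 (w u.2 * w k0 * e u.1))
                 (fun u : J * I => coord_pairs u.2 (s u.1)).
Proof.
case=> cs es; split=> [[j i] x|x] /=; first by rewrite -coord_mult_op coord_central.
have xE : co k0 (iota x * w k0) = x.
  rewrite coordZl -[w k0]mul1r -(rmorph1 iota).
  rewrite (_ : iota 1 * w k0 = \sum_i iota (i == k0)%:R * w i) ?coK ?eqxx ?mulr1 //.
  by rewrite (bigD1 k0) //= eqxx big1 ?addr0 // => i /negPf->; rewrite rmorph0 mul0r.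
have cw : w k0 \in @central T by case: cb.
rewrite -{1}xE {1}[iota x * w k0]es coord_sum.
rewrite -(pair_bigA _ (fun j i => mult_op (coord_pairs i (s j)) x *
                                  co k0 (w i * w k0 * e j))) /=.
apply: eq_bigr => j _; rewrite -w_comm mult_op_central //.
rewrite {1}[mult_op (s j) (iota x)]expand mulr_sumr mulr_suml coord_sum.
apply: eq_bigr => i _.
by rewrite -coord_mult_op -coordZl w_comm !mulrA.
Qed.

End CentralBasis.

(** * The skew group ring of an inner action of a cyclic group *)

Section InnerCyclicAction.
Variables (k : nzRingType) (A : algType k) (gT : finGroupType) (g : gT).
Variables (act : group_action gT A) (eta eta_inv : A).
Hypothesis g_generates : <[g]>%g = [set: gT].
Hypotheses (eta_mulV : eta * eta_inv = 1) (eta_mulVl : eta_inv * eta = 1).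
Hypothesis act_inner : forall (i : nat) (a : A),
  act (g ^+ i)%g a = eta ^+ i * a * eta_inv ^+ i.

Local Notation T := (skew_group_ring act).

Definition skew_const (a : A) : T := skew_monomial act a 1%g.

Fact skew_const_zmod_morphism : zmod_morphism skew_const.
Proof.
move=> a b; apply/ffunP => x; rewrite !ffunE.
by case: eqP; rewrite ?subrr.
Qed.

Fact skew_const_monoid_morphism : monoid_morphism skew_const.
Proof. by split=> // a b; rewrite skew_monomialM act_fun1 mulg1. Qed.

HB.instance Definition _ :=
  GRing.isZmodMorphism.Build A T skew_const skew_const_zmod_morphism.
HB.instance Definition _ :=
  GRing.isMonoidMorphism.Build A T skew_const skew_const_monoid_morphism.

Let eta_powV i : eta ^+ i * eta_inv ^+ i = 1.
Proof. by rewrite -exprMn_comm ?eta_mulV ?expr1n // /GRing.comm eta_mulV. Qed.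

Let eta_powVl i : eta_inv ^+ i * eta ^+ i = 1.
Proof. by rewrite -exprMn_comm ?eta_mulVl ?expr1n // /GRing.comm eta_mulV. Qed.

Let act_eta_inv i : act (g ^+ i)%g eta_inv = eta_inv.
Proof. by rewrite act_inner -mulrA -exprS exprSr mulrA eta_powV mul1r. Qed.

Let in_powers h : exists i, h = (g ^+ i)%g.
Proof. by apply/cycleP; rewrite g_generates inE. Qed.

(** Multiplication by eta^-1 cancels the conjugation by eta that g performs. *)
Lemma untwisted_generator_central : skew_monomial act eta_inv g \in @central T.
Proof.
apply/centralP => t; rewrite [t]skew_decomposition mulr_sumr mulr_suml.
apply: eq_bigr => h _; case: (in_powers h) => i ->.
rewrite !skew_monomialM act_eta_inv -expgS -expgSr; congr skew_monomial.
by rewrite -{1}(expg1 g) act_inner !mulrA eta_mulVl mul1r.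
Qed.

Lemma untwisted_power i :
  skew_monomial act eta_inv g ^+ i = skew_monomial act (eta_inv ^+ i) (g ^+ i)%g.
Proof.
by elim: i => [|i IHi] //; rewrite !exprSr IHi skew_monomialM act_eta_inv expgSr.
Qed.

(** Every h in the group is a power g^i, and u^i = eta^-i h for the central element
    u = eta^-1 g.  Any choice of the exponents i will do: another exponent changes
    eta^-i by a unit that is central in A. *)
Lemma skew_central_basis :
  exists (w : gT -> T) (co : gT -> T -> A), central_basis skew_const w co.
Proof.
have /choice[log logK] := in_powers.
pose w h : T := skew_monomial act (eta_inv ^+ log h) h.
have constM a h : skew_const a * w h = skew_monomial act (a * eta_inv ^+ log h) h.
  by rewrite skew_monomialM act_fun1 mul1g.
exists w, (fun h t => t h * eta ^+ log h); split=> [h|t|c h].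
- rewrite /w {2}(logK h) -untwisted_power rpredX //.
  exact: untwisted_generator_central.
- rewrite {1}[t]skew_decomposition; apply: eq_bigr => h _.
  by rewrite constM -mulrA eta_powV mulr1.
rewrite sum_ffunE (bigD1 h) //= big1 => [|j nj].
  by rewrite constM ffunE eqxx addr0 -mulrA eta_powVl mulr1.
by rewrite constM ffunE eq_sym (negPf nj).
Qed.

End InnerCyclicAction.

(** * Traces of idempotent matrices and dimensions *)

(** Let P = C B be a rank factorization: C is injective and B is surjective as a
    linear map on columns.  Then C B C B = C B gives B C = 1, a matrix whose size
    is the rank of P, and tr (C B) = tr (B C). *)
Lemma idempotent_mxtrace (F : fieldType) n (P : 'M[F]_n) :
  P *m P = P -> \tr P = (\rank P)%:R.
Proof.
move=> PP; rewrite -{1}(mulmx_base P) mxtrace_mulC.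
suff -> : row_base P *m col_base P = 1%:M by rewrite mxtrace1.
apply: (row_full_inj (col_base_full P)); apply: (row_free_inj (row_base_free P)).
by rewrite mulmx1 mulmxA -mulmxA !mulmx_base.
Qed.

(** The field is the field of fractions of Z.  Before it can be formed, inverses
    of the units of Z have to be chosen; the inverse function is the identity on
    the other elements. *)
Lemma domain_embeds_in_field (Z : comNzRingType) :
  (forall x y : Z, x * y = 0 -> x = 0 \/ y = 0) ->
  exists (F : fieldType) (f : {rmorphism Z -> F}), injective f.
Proof.
move=> domZ.
have /choice[inv invP] (x : Z) :
    exists y, if `[< exists z, z * x = 1 >] then y * x = 1 else y = x.
  by case: asboolP => [[y]|_]; [exists y | exists x].
pose uZ : {pred Z} := fun x => `[< exists z, z * x = 1 >].
have mulVx : {in uZ, left_inverse 1 inv *%R}.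
  by move=> x ux; have := invP x; rewrite ifT.
have unitPl x y : y * x = 1 -> uZ x by move=> yx; apply/asboolP; exists y.
have inv_out : {in [predC uZ], inv =1 id}.
  by move=> x ux; have := invP x; rewrite ifN.
pose ZU : comUnitRingType := HB.pack_for comUnitRingType (GRing.ComNzRing.sort Z) Z
  (GRing.ComNzRing_hasMulInverse.Build Z mulVx unitPl inv_out).
have int : GRing.integral_domain_axiom ZU.
  by move=> x y /domZ[]->; rewrite eqxx ?orbT.
pose D : idomainType := HB.pack_for idomainType (GRing.ComNzRing.sort Z) ZU
  (GRing.ComUnitRing_isIntegral.Build ZU int).
exists {fraction D}, (@FracField.tofrac D : {rmorphism D -> {fraction D}}) => x y /eqP.
by rewrite tofrac_eq => /eqP.
Qed.

Lemma domain_idempotent_mxtrace (Z : comNzRingType) n (P : 'M[Z]_n) :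
  (forall x y : Z, x * y = 0 -> x = 0 \/ y = 0) ->
  P *m P = P -> exists r : nat, \tr P = r%:R.
Proof.
move=> /domain_embeds_in_field[F [f f_inj]] PP; exists (\rank (map_mx f P)).
apply: f_inj; rewrite -trace_map_mx rmorph_nat.
by apply: idempotent_mxtrace; rewrite -map_mxM PP.
Qed.

Lemma dual_basis_matrix_idempotent (Z : comNzRingType) (M : lmodType Z) n
    (e : 'I_n -> M) f (P := \matrix_(i, j) f j (e i)) :
  dual_basis e f -> P *m P = P.
Proof.
case=> lf ef; apply/matrixP => i j; rewrite !mxE [e i in RHS]ef scalar_sum //.
by apply: eq_bigr => l _; rewrite !mxE.
Qed.

(** Let P be the idempotent matrix (f_j(e_i)).  Taking coordinates identifies V
    with the row space of P, because c |-> c P is the map that forms the linear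
    combination of the e_i and then takes its coordinates. *)
Lemma field_dual_basis_dimension (F : fieldType) (V : lmodType F) n
    (e : 'I_n -> V) f :
  dual_basis e f ->
  exists r, has_dimension V r /\ \sum_i f i (e i) = r%:R.
Proof.
move=> ef; set P := \matrix_(i, j) f j (e i).
have PP : P *m P = P by exact: dual_basis_matrix_idempotent.
exists (\rank P); split; last first.
  by rewrite -idempotent_mxtrace //; apply: eq_bigr => i _; rewrite mxE.
pose coords x : 'rV_n := \row_i f i x.
have coordsK x : lincomb e (coords x) = x.
  by rewrite [RHS]ef.2; apply: eq_bigr => i _; rewrite mxE.
have coords_lincomb c : coords (lincomb e c) = c *m P.
  apply/rowP => j; rewrite !mxE scalar_sum; last exact: ef.1.
  by apply: eq_bigr => i _; rewrite mxE.
have baseP : row_base P *m P = row_base P.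
  have /submxP[D ->] : (row_base P <= P)%MS by rewrite eq_row_base.
  by rewrite -mulmxA PP.
have combE (c : 'I_(\rank P) -> F) :
    \sum_i c i *: lincomb e (row i (row_base P)) =
    lincomb e ((\row_i c i) *m row_base P).
  rewrite mulmx_sum_row linear_sum.
  by apply: eq_bigr => i _; rewrite linearZ mxE.
exists (fun i => lincomb e (row i (row_base P))); split=> [x|c].
  have /submxP[D xD] : (coords x <= row_base P)%MS.
    by rewrite eq_row_base -[x]coordsK coords_lincomb submxMl.
  exists (fun i => D 0 i); rewrite combE (_ : \row_i D 0 i = D) -?xD ?coordsK //.
  by apply/rowP => i; rewrite mxE.
rewrite combE => /(congr1 coords); rewrite coords_lincomb -mulmxA baseP.
have -> : coords 0 = 0 by rewrite -(linear0 (lincomb e)) coords_lincomb mul0mx.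
rewrite -[0 in RHS](mul0mx _ (row_base P)) => /(row_free_inj (row_base_free P)).
by move=> /rowP c0 i; have := c0 i; rewrite !mxE.
Qed.

(** A quotient by a maximal ideal is a commutative ring in which nonzero elements
    are invertible; choosing inverses makes it a field on the same ring. *)
Lemma dual_basis_dimension (K : comNzRingType) (V : lmodType K) n
    (e : 'I_n -> V) f :
  (forall x : K, x != 0 -> exists y, y * x = 1) -> dual_basis e f ->
  exists r, has_dimension V r /\ \sum_i f i (e i) = r%:R.
Proof.
move=> invertible.
have /choice[inv invP] (x : K) : exists y, if x == 0 then y = 0 else y * x = 1.
  by case: (eqVneq x 0) => [_|/invertible[y]]; [exists 0 | exists y].
have mulVx (x : K) : x != 0 -> inv x * x = 1.
  by move=> x0; have := invP x; rewrite (negPf x0).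
have inv0 : inv 0 = 0 by have := invP 0; rewrite eqxx.
pose F : fieldType := HB.pack_for fieldType (GRing.ComNzRing.sort K) K
  (GRing.ComNzRing_isField.Build K mulVx inv0).
exact: (@field_dual_basis_dimension F V).
Qed.

(** * Reduction modulo a maximal ideal *)

Section MaximalIdeals.
Variables (Z : comNzRingType) (m : idealr Z).

(** If z is not in m, the ideal m + z Z strictly contains m, so it is not proper
    and contains 1. *)
Lemma maximal_ideal_quot_field :
  maximal_ideal m -> forall x : {ideal_quot m}, x != 0 -> exists y, y * x = 1.
Proof.
move=> maxm; elim/quotW => z.
rewrite -(rmorph0 \pi_{ideal_quot m}) -Quotient.idealrBE subr0 => mz.
pose J : {pred Z} := fun x => `[< exists a b, a \in m /\ x = a + b * z >].
have [/asboolP[a [b [ma ab1]]]|J1] := boolP (1 \in J).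
  exists (\pi_{ideal_quot m} b); rewrite -rmorphM -(rmorph1 \pi_{ideal_quot m}).
  by apply/eqP; rewrite -Quotient.idealrBE -[in _ - _]opprB ab1 addrK rpredN.
have J_ideal : idealr_closed J.
  split=> // [|c u v /asboolP[a [b [ma ->]]] /asboolP[a' [b' [ma' ->]]]].
    by apply/asboolP; exists 0, 0; rewrite mul0r addr0 rpred0.
  apply/asboolP; exists (c * a + a'), (c * b + b').
  by rewrite rpredD ?idealMr // mulrDr mulrDl mulrA addrACA.
pose Ji : idealr Z := HB.pack_for (idealr Z) J (isIdealr.Build Z J J_ideal).
case/negP: mz; apply: (maxm Ji) => [x mx|]; apply/asboolP.
  by exists x, 0; rewrite mul0r addr0.
by exists 0, 1; rewrite mul1r add0r rpred0.
Qed.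

Variable M : lmodType Z.

Lemma dual_basis_reduction (I : finType) (e : I -> M) (f : I -> M -> Z) :
  dual_basis e f ->
  exists f' : I -> reduction m M -> {ideal_quot m},
    @dual_basis _ (reduction m M) I (fun i => \pi_(reduction m M) (e i)) f' /\
    forall i x, f' i (\pi_(reduction m M) x) = \pi_{ideal_quot m} (f i x).
Proof.
case=> lf ef.
pose f' i (x : reduction m M) := \pi_{ideal_quot m} (f i (repr x)).
have f'E i x : f' i (\pi_(reduction m M) x) = \pi_{ideal_quot m} (f i x).
  apply/eqP; rewrite -Quotient.idealrBE; set y := repr _.
  have -> : f i y - f i x = f i (y - x).
    by rewrite -scaleN1r [y + _]addrC lf mulN1r addrC.
  have : y - x \in @ideal_mul Z m M by rewrite Quotient.idealrBE reprK.
  case/ideal_mulP => s [/allP ms ->]; rewrite scalar_sum // big_seq rpred_sum // => p ps.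
  by rewrite mulrC idealMr ?ms.
exists f'; split=> //; split=> [i|x].
  elim/quotW=> a; elim/quotW=> x; elim/quotW=> y.
  rewrite -[_ *: _]/(reduction_scale _ _) reduction_scale_pi -raddfD.
  by rewrite !f'E lf rmorphD rmorphM.
elim/quotW: x => x; rewrite {1}[x]ef raddf_sum; apply: eq_bigr => i _.
by rewrite f'E [RHS]reduction_scale_pi.
Qed.

End MaximalIdeals.

(** * The rank as a trace *)

Lemma cval_nat (R : nzRingType) r : cval (r%:R : centre R) = r%:R.
Proof. exact: (rmorph_nat (\val : {rmorphism centre R -> R})). Qed.

(** Equivalently, R is an algebra over the rational numbers. *)
Definition invertible_naturals (R : nzRingType) : Prop :=
  forall r, exists x : R, x * r.+1%:R = 1.

Lemma invertible_naturals_inj (R : nzRingType) :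
  invertible_naturals R -> injective (fun r => r%:R : R).
Proof.
move=> natV.
have le_inj r r' : (r <= r')%N -> r%:R = r'%:R :> R -> r = r'.
  move=> le_rr' eq_rr'; apply/eqP; rewrite eqn_leq le_rr' /= -subn_eq0.
  case def_d: (r' - r)%N => [//|d]; have [x] := natV d.
  by rewrite -def_d natrB // eq_rr' subrr mulr0 => /eqP; rewrite eq_sym oner_eq0.
by move=> r r' eq_rr'; case/orP: (leq_total r r') => /le_inj-> //; rewrite eq_rr'.
Qed.

Lemma invertible_naturals_rmorph (R S : nzRingType) (f : {rmorphism R -> S}) :
  invertible_naturals R -> invertible_naturals S.
Proof.
move=> natV r; have [x xr] := natV r; exists (f x).
by rewrite -(rmorph_nat f) -rmorphM xr rmorph1.
Qed.

Lemma invertible_naturals_centre (R : nzRingType) :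
  invertible_naturals R -> invertible_naturals (centre R).
Proof.
move=> natV r; have [x xr] := natV r.
have nat_comm (y : R) : r.+1%:R * y = y * r.+1%:R by rewrite mulr_natl mulr_natr.
have cx : x \in @central R.
  apply/centralP => y; rewrite -[LHS]mulr1 -xr -nat_comm mulrA -(mulrA x y).
  by rewrite -nat_comm mulrA xr mul1r.
exists (Centre cx); apply: val_inj.
rewrite -[RHS]/(1 : R) -xr -[LHS]/(x * cval _).
by rewrite cval_nat.
Qed.

Section Rank.
Variable R : nzRingType.

(** A central element z generates the two-sided ideal z R, and
    (x R) (y R) = x y R when x and y are central. *)
Lemma centre_domain :
  prime_ring R -> forall x y : centre R, x * y = 0 -> x = 0 \/ y = 0.
Proof.
move=> primeR x y xy0; pose gen (z : centre R) (u : R) := exists v, u = cval z * v.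
have gen_ideal z : two_sided_ideal (gen z).
  have cz : forall v, cval z * v = v * cval z by apply/centralP/cvalP.
  split=> [|_ _ [u ->] [v ->]|a _ [u ->]].
  - by exists 0; rewrite mulr0.
  - by exists (u - v); rewrite mulrBr.
  - split; last by exists (u * a); rewrite mulrA.
    by exists (a * u); rewrite !mulrA cz.
have gen1 z : gen z (cval z) by exists 1; rewrite mulr1.
case: (primeR _ _ (gen_ideal x) (gen_ideal y)) => [_ _ [u ->] [v ->]|x0|y0].
- have cy : forall v, cval y * v = v * cval y by apply/centralP/cvalP.
  rewrite -mulrA (mulrA u) -cy -mulrA mulrA.
  by rewrite -[cval x * _]/(cval (x * y)) xy0 mul0r.
- by left; apply: val_inj; apply: x0.
- by right; apply: val_inj; apply: y0.
Qed.

Variables (n : nat) (e : 'I_n -> R) (s : 'I_n -> seq (R * R)).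
Hypothesis es : azumaya_system e s.

Definition system_trace : R := \sum_i mult_op (s i) (e i).

Lemma cval_system_trace :
  cval (\sum_i coordinate es i (e i)) = system_trace.
Proof. exact: (raddf_sum (\val : {rmorphism centre R -> R})). Qed.

Lemma prime_system_trace : prime_ring R -> exists r : nat, system_trace = r%:R.
Proof.
move=> /centre_domain domZ.
have PP := dual_basis_matrix_idempotent (system_dual_basis es).
have [r tr] := domain_idempotent_mxtrace domZ PP.
exists r; rewrite -cval_system_trace -cval_nat -tr.
by congr cval; apply: eq_bigr => i _; rewrite mxE.
Qed.

(** Modulo a maximal ideal the system becomes a dual basis of a vector space whose
    dimension r' is the reduced trace r as an element of the residue field; this
    forces r = r' because natural numbers remain distinct there. *)
Lemma rank_of_system_trace (r : nat) :
  invertible_naturals R -> system_trace = r%:R -> has_rank R r.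
Proof.
move=> natV tr m maxm.
have [f' [ef' f'E]] := dual_basis_reduction m (system_dual_basis es).
have [r' [dim_r' tr']] := dual_basis_dimension (maximal_ideal_quot_field maxm) ef'.
have natV_quot : invertible_naturals {ideal_quot m}.
  exact/(invertible_naturals_rmorph (\pi_{ideal_quot m} : {rmorphism _ -> _}))
       /invertible_naturals_centre.
suff -> : r = r' by [].
apply: (invertible_naturals_inj natV_quot); rewrite -tr' -(rmorph_nat \pi_{ideal_quot m}).
have -> : r%:R = \sum_i coordinate es i (e i).
  apply: val_inj; rewrite -[RHS]/(cval _) cval_system_trace tr.
  by rewrite -[LHS]/(cval _) cval_nat.
by rewrite raddf_sum; apply: eq_bigr => i _; rewrite f'E.
Qed.

End Rank.

Theorem theorem1p3
    (k : closedFieldType) (char_k : [pchar k] =i pred0)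
    (A : algType k) (A_prime : prime_ring A)
    (n : nat) (gT : finGroupType) (g : gT)
    (g_generates : <[g]>%g = [set: gT]) (g_order : #[g]%g = n)
    (act : group_action gT A)
    (eta eta_inv : A)
    (eta_mulV : eta * eta_inv = 1) (eta_mulVl : eta_inv * eta = 1)
    (act_inner : forall (i : nat) (a : A),
       act (g ^+ i)%g a = eta ^+ i * a * eta_inv ^+ i)
    (T_prime : prime_ring (skew_group_ring act)) :
  (azumaya A <-> azumaya (skew_group_ring act)) /\
  (azumaya A ->
     exists r : nat, has_rank A r /\ has_rank (skew_group_ring act) r).
Proof.
have [w [co cb]] := skew_central_basis g_generates eta_mulV eta_mulVl act_inner.
split; first split.
- move=> /azumaya_system_exists[m [e [s es]]].
  exact: azumaya_of_system (azumaya_system_ascent cb es).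
- move=> /azumaya_system_exists[m [e [s es]]].
  exact: azumaya_of_system (azumaya_system_descent cb g es).
move=> /azumaya_system_exists[m [e [s es]]].
have [r tr] := prime_system_trace es A_prime.
have natV : invertible_naturals A.
  apply: (invertible_naturals_rmorph (in_alg A)) => i.
  by exists i.+1%:R^-1; rewrite mulVf // (pcharf0P k).1.
exists r; split; first exact: (rank_of_system_trace es natV tr).
apply: (rank_of_system_trace (azumaya_system_ascent cb es)).
  exact: (invertible_naturals_rmorph (skew_const act) natV).
rewrite /system_trace -(rmorph_nat (skew_const act)) -tr rmorph_sum.
by apply: eq_bigr => i _; rewrite (mult_op_image (skew_const act)).
Qed.
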